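(* Let $d\in\mathbb{N}$ and let $\mathcal{H}$ be any hash family on $\{0,1\}^d$. Then the function $t\mapsto \mathbb{K}_{\mathcal{H}}(t)$ is log-convex in $t\in[0,\infty)$, where $$\mathbb{K}_{\mathcal{H}}(t)=\Pr_{h\sim\mathcal{H},\ (x,y)\ e^{-t}\text{-correlated}}[h(x)=h(y)].$$
   Context: A hash family on $\{0,1\}^d$ is a probability distribution $\mathcal{H}$ over functions $h:\{0,1\}^d\to U$, where $U$ is a finite or countably infinite set. For $0<\rho\le1$, $(x,y)$ are $\rho$-correlated random strings in $\{0,1\}^d$ if $x$ is uniformly random in $\{0,1\}^d$ and $y$ is formed by rerandomizing each coordinate of $x$ independently with probability $1-\rho$ (that is, each coordinate is, independently, kept with probability $\rho$ and replaced by a fresh uniformly random bit with probability $1-\rho$). In the definition of $\mathbb{K}_{\mathcal{H}}(t)$, $h$ is drawn independently of $(x,y)$. A positive function is log-convex if its logarithm is convex. *)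

(* Defs.v *)
From HB Require Import structures.
From mathcomp Require Import all_boot all_order all_algebra.
From mathcomp Require Import all_classical all_reals all_analysis.
Set Implicit Arguments.
Unset Strict Implicit.
Unset Printing Implicit Defensive.
Import Order.TTheory GRing.Theory Num.Theory.
Import numFieldNormedType.Exports.
Local Open Scope classical_set_scope.
Local Open Scope ring_scope.

Definition cube (d : nat) : Type := d.-tuple bool.

HB.instance Definition _ (d : nat) := Finite.on (cube d).
HB.instance Definition _ (d : nat) := Measurable.on (cube d).

Section iid_bits.
Context {R : realType} (P : probability bool R) (d : nat).
Local Open Scope ereal_scope.

(* The law of d independent bits, each with law P. *)
Definition iid_pmf (s : cube d) : R := (\prod_(i < d) fine (P [set tnth s i]))%R.

Definition iid_bits (A : set (cube d)) : \bar R := \sum_(s \in A) (iid_pmf s)%:E.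

Let pmf_ge0 s : (0 <= iid_pmf s)%R.
Proof. by apply: prodr_ge0 => i _; exact: fine_ge0. Qed.

Let pmf_sum1 : (\sum_(s : cube d) iid_pmf s)%R = 1%R.
Proof.
have bool1 : (\sum_(b : bool) fine (P [set b]))%R = 1%R.
  apply: EFin_inj; rewrite big_bool/= EFinD !fineK ?fin_num_measure//.
  rewrite -measureU//; last by apply/seteqP; split=> // b [/= -> ].
  by rewrite -(probability_setT P) setT_bool.
rewrite -[RHS](expr1n _ d) -[in RHS]bool1 -[d in RHS]card_ord -prodr_const.
rewrite bigA_distr_bigA/=.
rewrite (reindex (fun f : {ffun 'I_d -> bool} => [tuple f i | i < d]))/=; last first.
  exists (fun s : d.-tuple bool => [ffun i => tnth s i]) => [f _|s _].
    by apply/ffunP => i; rewrite ffunE tnth_mktuple.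
  by apply: eq_from_tnth => i; rewrite tnth_mktuple ffunE.
by apply: eq_bigr => f _; apply: eq_bigr => i _; rewrite tnth_mktuple.
Qed.

Let iid_bits_esum A : iid_bits A = \esum_(s in A) (iid_pmf s)%:E.
Proof.
rewrite /iid_bits esum_fset//; first exact: finite_finset.
by move=> s _; rewrite lee_fin.
Qed.

Let iid_bits0 : iid_bits set0 = 0.
Proof. by rewrite /iid_bits fsbig_set0. Qed.

Let iid_bits_ge0 A : 0 <= iid_bits A.
Proof. by rewrite iid_bits_esum; apply: esum_ge0 => s _; rewrite lee_fin. Qed.

Let iid_bits_sigma_additive : semi_sigma_additive iid_bits.
Proof.
move=> F mF tF mUF; apply: cvg_toP.
  by apply: ereal_nondecreasing_is_cvgn => m n mn; exact: lee_sum_nneg_natr.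
rewrite iid_bits_esum nneseries_sum_bigcup//.
by apply: eq_eseriesr => k _; rewrite iid_bits_esum.
Qed.

HB.instance Definition _ := isMeasure.Build _ _ _ iid_bits
  iid_bits0 iid_bits_ge0 iid_bits_sigma_additive.

Let iid_bits_setT : iid_bits [set: cube d] = 1.
Proof.
rewrite /iid_bits fsbig_finite; last exact: finite_finset.
rewrite (perm_big (index_enum (cube d)))/=.
  by rewrite sumEFin pmf_sum1.
apply: uniq_perm => [||s]; [exact: finmap.fset_uniq|exact: index_enum_uniq|].
rewrite mem_index_enum in_fset_set; last exact: finite_finset.
by rewrite in_setT.
Qed.

HB.instance Definition _ :=
  Measure_isProbability.Build _ _ R iid_bits iid_bits_setT.

End iid_bits.
Arguments iid_bits {R} P d A.

Lemma measurable_cube (d : nat) (A : set (cube d)) : measurable A.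
Proof.
apply: countable_measurable => [t|]; last exact/finite_set_countable/finite_finset.
have -> : [set t] = \bigcap_(i in [set: 'I_d]) ((@tnth d bool ^~ i) @^-1` [set tnth t i]).
  apply/seteqP; split => [s /= -> //|s /= st].
  by apply: eq_from_tnth => i; exact: st.
apply: fin_bigcap_measurable => [|i _]; first exact: finite_finset.
rewrite -[X in measurable X]setTI; exact: measurable_tnth.
Qed.

(* w = (x, (keep, fresh)) *)
Definition rerandomize d (w : cube d * (cube d * cube d)) : cube d :=
  [tuple if tnth w.2.1 i then tnth w.1 i else tnth w.2.2 i | i < d].

Definition correlated_pair d (w : cube d * (cube d * cube d)) := (w.1, rerandomize w).

Lemma measurable_correlated_pair d : measurable_fun setT (@correlated_pair d).
Proof.
move=> _ A mA; rewrite setTI.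
apply: countable_measurable; last exact/finite_set_countable/finite_finset.
move=> [x [k z]].
have -> : [set (x, (k, z))] = [set x] `*` ([set k] `*` [set z]).
  by apply/seteqP; split => [w /= ->|[? [? ?]]/= [-> [-> ->]]].
by apply: measurableX; [|apply: measurableX]; exact: measurable_cube.
Qed.

HB.instance Definition _ d :=
  isMeasurableFun.Build _ _ _ _ _ (@measurable_correlated_pair d).

(* The law of (x, y), where bit i of y is that of x with probability rho and a
   fresh uniform bit otherwise; meaningful for 0 <= rho <= 1, as [bernoulli_prob]
   is a default value outside this range. *)
Definition correlated (R : realType) (d : nat) (rho : R) :
    set (cube d * cube d) -> \bar R :=
  let uniform := iid_bits (bernoulli_prob 2^-1) d in
  let keep := iid_bits (bernoulli_prob rho) d in
  pushforward (uniform \x (keep \x uniform))%E (@correlated_pair d).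
Arguments correlated {R} d rho.

(* Functions to U with the discrete sigma-algebra: when U is countable there are
   countably many of them, so every distribution extends to all subsets. *)
Definition hash_fun (d : nat) (U : pointedType) : Type := cube d -> U.

HB.instance Definition _ d U := Pointed.on (hash_fun d U).
HB.instance Definition _ d U := @isMeasurable.Build default_measure_display
  (hash_fun d U) discrete_measurable discrete_measurable0
  discrete_measurableC discrete_measurableU.

Definition hash_family (R : realType) d U := probability (hash_fun d U) R.

(* The product measure makes the hash function independent of (x, y). *)
Definition collision (R : realType) d U (H : hash_family R d U) (t : R) : R :=
  fine ((H \x correlated d (expR (- t)))%E
    [set w : hash_fun d U * (cube d * cube d) | w.1 w.2.1 = w.1 w.2.2]).

Definition log_convex (R : realType) (D : set R) (f : R -> R) : Prop :=
  (forall t, D t -> 0 < f t) /\ convex_function (D : set R^o) (fun t => ln (f t)).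

(* Main.v *)
Require Import Defs.
From mathcomp Require Import all_boot all_order all_algebra.
From mathcomp Require Import all_classical all_reals all_analysis.
From mathcomp Require Import ring lra.
Set Implicit Arguments.
Unset Strict Implicit.
Unset Printing Implicit Defensive.
Import Order.TTheory GRing.Theory Num.Theory.
Import numFieldNormedType.Exports.
Local Open Scope classical_set_scope.
Local Open Scope ring_scope.

(* With u ranging over the values of h, the Fourier expansion of the indicators
   1_{h = u} gives, for rho-correlated x and y,
     Pr[h x = h y] = \sum_J rho^#|J| w_J(h),
   where w_J(h) >= 0 is the sum over u of the squared Fourier coefficients of
   1_{h = u} at J.  Averaging over h, the collision probability at rho = e^{-t}
   is a nonnegative combination of the exponentials e^{-#|J| t}, and such
   combinations are log-convex by Hoelder's inequality; positivity comes from
   the term J = set0. *)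

(** * Log-convexity of nonnegative combinations of exponentials *)

Lemma log_convex_sum_expR (R : realType) (I : finType) (w c : I -> R) (j : I)
    (D : set R) :
  (forall i, 0 <= w i) -> 0 < w j ->
  log_convex D (fun t => \sum_i w i * expR (c i * t)).
Proof.
move=> w0 wj; set f := fun t => _.
have f0 t : 0 < f t.
  rewrite /f (bigD1 j)//= ltr_pwDl ?mulr_gt0 ?expR_gt0//.
  by apply: sumr_ge0 => i _; rewrite mulr_ge0 ?expR_ge0.
split=> [t _|l x y _ _]; first exact: f0.
(* [L] interpolates [ln (f x)] and [ln (f y)], and [z] interpolates [x] and [y]; the claim
   [ln (f z) <= L] becomes [f z / expR L <= 1]. *)
set L := (X in _ <= X); set z := conv _ _ _.
rewrite -[L]expRK ler_ln ?posrE ?expR_gt0 ?f0//.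
rewrite -[expR L]mul1r -ler_pdivrMr ?expR_gt0// -expRN mulr_suml.
have sum1 t : \sum_i w i * expR (c i * t - ln (f t)) = 1.
  under eq_bigr do rewrite expRD expRN lnK ?posrE ?f0// mulrA.
  by rewrite -mulr_suml divff// gt_eqF ?f0.
(* Hoelder's inequality: by convexity of expR, each summand over e^L is at most
   the average of the summands over f x and f y. *)
rewrite -(subrKC l%:num 1) -{1}[l%:num]mulr1 -[_ - _]mulr1.
rewrite -{1}(sum1 x) -{2}(sum1 y) !mulr_sumr -big_split/=.
apply: ler_sum => i _; rewrite -mulrA -expRD mulrCA [X in _ <= _ + X]mulrCA -mulrDr.
apply: ler_wpM2l => //.
have -> : c i * z - L
    = conv l (c i * x - ln (f x) : R^o) (c i * y - ln (f y) : R^o).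
  rewrite /z /L; change (c i * (l%:num * x + (1 - l%:num) * y)
    - (l%:num * ln (f x) + (1 - l%:num) * ln (f y))
    = l%:num * (c i * x - ln (f x)) + (1 - l%:num) * (c i * y - ln (f y))).
  by ring.
exact: convex_expR.
Qed.

(** * Finite sums, finite probability spaces and Walsh functions *)

(** Grouping by the fibers of [h] turns the double sum into a sum of squares, one for each fiber. *)
Lemma sum_eq_fiber_ge0 (R : realDomainType) (T : finType) (U : eqType)
    (h : T -> U) (c : T -> R) :
  0 <= \sum_a \sum_b (h a == h b)%:R * (c a * c b).
Proof.
(* [U] need not be finite, so a fiber is indexed by a chosen representative in the finite type
   [option T] rather than by its value. *)
pose r a := [pick b | h b == h a].
have rE a b : (r a == r b) = (h a == h b).
  apply/eqP/eqP => [|hab]; last by apply: eq_pick => x; rewrite hab.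
  rewrite /r; case: pickP => [x /eqP <-|/(_ a)]; last by rewrite eqxx.
  by case: pickP => [y /eqP <- [->]|].
rewrite (partition_big r xpredT)//=; apply: sumr_ge0 => o _.
have -> : \sum_(a | r a == o) \sum_b (h a == h b)%:R * (c a * c b)
    = (\sum_(a | r a == o) c a) ^+ 2.
  rewrite expr2 mulr_suml; apply: eq_bigr => a /eqP <-.
  rewrite mulr_sumr [RHS]big_mkcond/=; apply: eq_bigr => b _.
  by rewrite -rE eq_sym; case: eqP; rewrite ?mul1r ?mul0r.
exact: sqr_ge0.
Qed.

Lemma sum_tuple_prod (R : comPzSemiRingType) (d : nat) (T : finType)
    (F : 'I_d -> T -> R) :
  \sum_(s : d.-tuple T) \prod_i F i (tnth s i) = \prod_i \sum_c F i c.
Proof.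
rewrite bigA_distr_bigA (reindex (fun s : d.-tuple T => [ffun i => tnth s i])).
  by apply: eq_bigr => s _; apply: eq_bigr => i _; rewrite ffunE.
exists (fun f : {ffun 'I_d -> T} => [tuple f i | i < d]) => [s _|f _].
  by apply: eq_from_tnth => i; rewrite tnth_mktuple ffunE.
by apply/ffunP => i; rewrite ffunE tnth_mktuple.
Qed.

Lemma probability_sum_set1 (R : realType) (disp : measure_display)
    (T : measurableType disp) (mu : probability T R) (s : seq T)
    (A : set T) :
  uniq s -> (forall t, t \in s) -> (forall t : T, measurable [set t]) ->
  mu A = (\sum_(t <- s | t \in A) mu [set t])%E.
Proof.
move=> us sT m1; rewrite -big_filter fsbig_seq ?filter_uniq//.
rewrite -measure_fin_bigcup//; last first.
  apply/trivIsetP => i j _ _ ij; apply/seteqP; split=> // t [/= ->] /eqP.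
  by rewrite (negbTE ij).
congr (mu _); apply/seteqP; split => [t At|t [u/=]].
  by exists t => //=; rewrite mem_filter sT andbT inE.
by rewrite mem_filter => /andP[]; rewrite inE => Au _ ->.
Qed.

(** These are the characters of the group of bit strings, with bits read as signs. *)
Definition walsh (R : realType) (d : nat) (J : {set 'I_d}) (a : cube d) : R :=
  \prod_(i in J) (-1) ^+ (tnth a i).

Lemma normr_walsh (R : realType) (d : nat) (J : {set 'I_d}) (a : cube d) :
  `|walsh R J a| = 1.
Proof. by rewrite normr_prod big1// => i _; rewrite normrX normrN1 expr1n. Qed.

(** * The law of a correlated pair *)

Lemma fine_bernoulli_prob_set1 (R : realType) (p : R) (b : bool) : 0 <= p <= 1 ->
  fine (bernoulli_prob p [set b]) = if b then p else 1 - p.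
Proof.
move=> p01; rewrite bernoulli_probE// !diracE.
have inb c : (c \in [set b]) = (c == b) by apply/idP/eqP; rewrite inE.
by rewrite !inb; case: b {inb}; rewrite /= ?mulr0 ?mulr1 ?add0r ?addr0.
Qed.

Lemma set1_triple (T1 T2 T3 : Type) (x : T1) (y : T2) (z : T3) :
  [set (x, (y, z))] = [set x] `*` ([set y] `*` [set z]).
Proof. by apply/seteqP; split => [w /= ->|[? [? ?]]/= [-> [-> ->]]]. Qed.

Lemma product_iid_bits_set1 (R : realType) (d : nat) (P Q S : probability bool R)
    (x k z : cube d) :
  (iid_bits P d \x (iid_bits Q d \x iid_bits S d))%E [set (x, (k, z))]
  = (iid_pmf P x * (iid_pmf Q k * iid_pmf S z))%:E.
Proof.
rewrite set1_triple.
pose QS := (iid_bits Q d \x iid_bits S d)%E : probability _ R.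
transitivity (iid_bits P d [set x] * QS ([set k] `*` [set z]))%E.
  by apply: (product_measure1E (iid_bits P d) QS);
    [|apply: measurableX]; exact: measurable_cube.
have -> : QS ([set k] `*` [set z]) = (iid_bits Q d [set k] * iid_bits S d [set z])%E.
  by apply: product_measure1E; exact: measurable_cube.
by rewrite /iid_bits !fsbig_set1 !EFinM.
Qed.

(** The conditional law of [y] given [x] factors over coordinates: bit [i] of [y] agrees with that
    of [x] with probability [rho + (1 - rho) / 2 = (1 + rho) / 2] and differs with probability
    [(1 - rho) / 2]. *)
Lemma rerandomize_pmf (R : realType) (d : nat) (rho : R) (x y : cube d) :
  0 <= rho <= 1 ->
  \sum_k \sum_z iid_pmf (bernoulli_prob rho) k *
      iid_pmf (bernoulli_prob 2^-1) z * (rerandomize (x, (k, z)) == y)%:R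
  = 2^-1 ^+ d * \prod_(i < d) (1 + rho * ((-1) ^+ tnth x i * (-1) ^+ tnth y i)).
Proof.
move=> rho01.
have half01 : 0 <= (2^-1 : R) <= 1 by lra.
have -> : 2^-1 ^+ d = \prod_(i < d) 2^-1 :> R by rewrite prodr_const card_ord.
rewrite -big_split/=.
(* [F i k] is the contribution of coordinate [i] when its keep bit is [k], summed over its fresh bit
   [z]. *)
pose F i k := \sum_(z : bool) (if k then rho else 1 - rho) * 2^-1 *
  ((if k then tnth x i else z) == tnth y i)%:R.
transitivity (\prod_i \sum_k F i k); last first.
  apply: eq_bigr => i _; rewrite /F !big_bool/=.
  by case: (tnth x i); case: (tnth y i) => /=; field.
rewrite -sum_tuple_prod; apply: eq_bigr => k _.
rewrite /F -(sum_tuple_prod (fun i z => (if tnth k i then rho else 1 - rho) * 2^-1 *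
  ((if tnth k i then tnth x i else z) == tnth y i)%:R)).
apply: eq_bigr => z _; rewrite /iid_pmf -!big_split/=.
(* The indicator of equality of two strings is the product of the coordinatewise indicators. *)
have -> : (rerandomize (x, (k, z)) == y)%:R
    = \prod_i (tnth (rerandomize (x, (k, z))) i == tnth y i)%:R :> R.
  case: eqP => [->|xy]; first by rewrite big1// => i _; rewrite eqxx.
  have /existsP[i xyi] :
      [exists i, tnth (rerandomize (x, (k, z))) i != tnth y i].
    apply: contra_notT xy; rewrite negb_exists => /forallP xy.
    by apply: eq_from_tnth => i; apply/eqP/negPn/xy.
  by rewrite (bigD1 i)//= (negbTE xyi) mul0r.
rewrite -big_split/=; apply: eq_bigr => i _.
rewrite !fine_bernoulli_prob_set1// /rerandomize tnth_mktuple/=.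
by congr (_ * _ * _); case: (tnth z i); field.
Qed.

Lemma iid_pmf_uniform (R : realType) (d : nat) (x : cube d) :
  iid_pmf (bernoulli_prob (2^-1 : R)) x = 2^-1 ^+ d.
Proof.
rewrite -[d in RHS]card_ord -prodr_const; apply: eq_bigr => i _.
by rewrite fine_bernoulli_prob_set1; [case: (tnth x i); field|lra].
Qed.

(** Of the factor [4^-1 ^+ d], one [2^-1 ^+ d] is the mass of [x] and the other comes from
    [rerandomize_pmf]. *)
Lemma correlatedE (R : realType) (d : nat) (rho : R)
    (A : set (cube d * cube d)) : 0 <= rho <= 1 ->
  correlated d rho A = (4^-1 ^+ d * \sum_x \sum_y ((x, y) \in A)%:R *
    \prod_i (1 + rho * ((-1) ^+ tnth x i * (-1) ^+ tnth y i)))%:E.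
Proof.
move=> rho01; rewrite /correlated /pushforward.
pose u := iid_bits (bernoulli_prob (2^-1 : R)) d.
pose ku := (iid_bits (bernoulli_prob rho) d \x u)%E : probability _ R.
pose mu := (u \x ku)%E : probability _ R.
have muE w : mu [set w] = (2^-1 ^+ d * (iid_pmf (bernoulli_prob rho) w.2.1 *
    iid_pmf (bernoulli_prob 2^-1) w.2.2))%:E.
  case: w => x [k z]; rewrite -(iid_pmf_uniform _ x).
  exact: product_iid_bits_set1.
rewrite -/u [LHS](@probability_sum_set1 _ _ _ mu (index_enum _)) ?index_enum_uniq//.
- under eq_bigr => w _ do rewrite muE.
  rewrite sumEFin; congr EFin.
  rewrite big_mkcond/=.
  pose F x (kz : cube d * cube d) : R := ((x, rerandomize (x, kz)) \in A)%:R *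
    (2^-1 ^+ d *
      (iid_pmf (bernoulli_prob rho) kz.1 * iid_pmf (bernoulli_prob 2^-1) kz.2)).
  transitivity (\sum_x \sum_kz F x kz).
    rewrite pair_bigA/=; apply: eq_bigr => -[x [k z]] _; rewrite /F/=.
    have -> : ((x, (k, z)) \in @correlated_pair d @^-1` A)
        = ((x, rerandomize (x, (k, z))) \in A) by apply/idP/idP; rewrite !inE.
    by case: ifP; rewrite ?mul1r ?mul0r.
  rewrite mulr_sumr; apply: eq_bigr => x _; rewrite mulr_sumr.
  under [RHS]eq_bigr => y _.
    rewrite mulrCA (_ : 4^-1 = 2^-1 * 2^-1); last by field.
    rewrite exprMn -mulrA -rerandomize_pmf// pair_bigA/= !mulr_sumr.
    over.
  (* Once [x], [k] and [z] are fixed, a single [y] contributes to the inner sum. *)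
  rewrite exchange_big/=; apply: eq_bigr => -[k z] _.
  rewrite (bigD1 (rerandomize (x, (k, z))))//= eqxx mulr1 big1 ?addr0//.
  by move=> y; rewrite eq_sym => /negbTE ->; rewrite !mulr0.
- by move=> w; rewrite mem_index_enum.
- move=> [x [k z]]; rewrite set1_triple.
  by apply: measurableX; [|apply: measurableX]; exact: measurable_cube.
Qed.

(** * Fourier expansion of the collision probability for a fixed hash function *)

Lemma prod_noise_walsh (R : realType) (d : nat) (rho : R) (x y : cube d) :
  \prod_(i < d) (1 + rho * ((-1) ^+ tnth x i * (-1) ^+ tnth y i)) =
  \sum_(J : {set 'I_d}) rho ^+ #|J| * (walsh R J x * walsh R J y).
Proof.
(* Putting the [rho] term first makes [J] the set of factors from which that term is chosen when the
   product is expanded. *)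
under eq_bigr do rewrite addrC.
rewrite bigA_distr; apply: eq_bigr => J _.
rewrite -big_mkcond/= !big_split/= prodr_const.
by rewrite /walsh.
Qed.

(* Equals \sum_u (2^-d \sum_(x | h x = u) walsh J x)^2. *)
Definition fourier_weight (R : realType) (d : nat) (U : eqType)
    (J : {set 'I_d}) (h : cube d -> U) : R :=
  4^-1 ^+ d * \sum_x \sum_y (h x == h y)%:R * (walsh R J x * walsh R J y).

Lemma fourier_weight_ge0 (R : realType) (d : nat) (U : eqType)
    (J : {set 'I_d}) (h : cube d -> U) : 0 <= fourier_weight R J h.
Proof.
by rewrite mulr_ge0 ?exprn_ge0 ?invr_ge0//; exact: sum_eq_fiber_ge0.
Qed.

(** A crude bound, but uniform in [h], which gives integrability over the hash family. *)
Lemma fourier_weight_le (R : realType) (d : nat) (U : eqType)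
    (J : {set 'I_d}) (h : cube d -> U) :
  fourier_weight R J h <= 4^-1 ^+ d * (#|{: cube d}| * #|{: cube d}|)%:R.
Proof.
rewrite ler_wpM2l ?exprn_ge0 ?invr_ge0// -sum_nat_const natr_sum.
apply: ler_sum => x _; rewrite -sum1_card natr_sum; apply: ler_sum => y _.
apply: (le_trans (ler_norm _)); rewrite !normrM !normr_walsh !mulr1.
by rewrite normr_nat lern1; case: eqP.
Qed.

(** All terms are nonnegative for the empty set, and one diagonal term already gives the bound. Its
    uniformity in [h] keeps the average positive. *)
Lemma fourier_weight0_ge (R : realType) (d : nat) (U : eqType)
    (h : cube d -> U) : 4^-1 ^+ d <= fourier_weight R finset.set0 h.
Proof.
rewrite -[leLHS]mulr1 ler_wpM2l ?exprn_ge0 ?invr_ge0//.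
have ge0 x y : 0 <= (h x == h y)%:R *
    (walsh R finset.set0 x * walsh R finset.set0 y) :> R.
  by rewrite /walsh !big_set0 !mulr1.
rewrite (bigD1 [tuple false | i < d])//= (bigD1 [tuple false | i < d])//=.
rewrite eqxx {1 2}/walsh !big_set0 !mulr1 -addrA lerDl.
by rewrite addr_ge0 ?sumr_ge0// => x _; rewrite ?sumr_ge0.
Qed.

Lemma correlated_collision (R : realType) (d : nat) (U : eqType) (rho : R)
    (h : cube d -> U) : 0 <= rho <= 1 ->
  correlated d rho [set p | h p.1 = h p.2] =
  (\sum_(J : {set 'I_d}) (rho ^+ #|J|)%:E * (fourier_weight R J h)%:E)%E.
Proof.
move=> rho01; rewrite correlatedE//.
under [RHS]eq_bigr do rewrite -EFinM.
rewrite sumEFin; congr EFin.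
under [RHS]eq_bigr do rewrite mulrCA.
rewrite -mulr_sumr; congr (_ * _).
under [RHS]eq_bigr do rewrite mulr_sumr.
rewrite [RHS]exchange_big/=; apply: eq_bigr => x _.
under [RHS]eq_bigr do rewrite mulr_sumr.
rewrite [RHS]exchange_big/=; apply: eq_bigr => y _.
rewrite prod_noise_walsh mulr_sumr; apply: eq_bigr => J _.
have -> : ((x, y) \in [set p | h p.1 = h p.2]) = (h x == h y).
  by apply/idP/eqP; rewrite inE.
by rewrite mulrCA.
Qed.

(** * Averaging over the hash function *)

Lemma integrable_fourier_weight (R : realType) (d : nat) (U : pointedType)
    (H : hash_family R d U) (J : {set 'I_d}) :
  H.-integrable [set: hash_fun d U] (EFin \o fourier_weight R J).
Proof.
apply: measurable_bounded_integrable => //.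
  by rewrite [ltLHS]probability_setT ltry.
exists (4^-1 ^+ d * (#|{: cube d}| * #|{: cube d}|)%:R); split; first exact: num_real.
move=> M ltM h _ /=; rewrite ger0_norm ?fourier_weight_ge0//.
exact: le_trans (fourier_weight_le R J h) (ltW ltM).
Qed.

Lemma collisionE (R : realType) (d : nat) (U : pointedType)
    (H : hash_family R d U) (t : R) : 0 <= t ->
  collision H t = \sum_(J : {set 'I_d})
    (\int[H]_h fourier_weight R J h) * expR (- #|J|%:R * t).
Proof.
move=> t0.
(* Here [0 <= t] keeps [expR (- t)] in the range where [bernoulli_prob] is not a default value. *)
have rho01 : 0 <= expR (- t) <= 1 by rewrite expR_ge0 -[leRHS]expR0 ler_expR oppr_le0.
(* The product measure integrates, over [h], the correlated mass of the section of the collision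
   event at [h]. *)
rewrite /collision /product_measure1.
under eq_integral => h _.
  rewrite /= [X in correlated _ _ X](_ : _ = [set p | h p.1 = h p.2]); last first.
    by apply/seteqP; split => p; rewrite /xsection/= inE.
  rewrite correlated_collision//.
  over.
have fin J : (\int[H]_h (fourier_weight R J h)%:E)%E \is a fin_num.
  by apply: integrable_fin_num => //; exact: integrable_fourier_weight.
have mw J := measurable_int _ (integrable_fourier_weight H J).
rewrite ge0_integral_sum//; last first.
  move=> J h _; rewrite -EFinM lee_fin.
  by rewrite mulr_ge0 ?exprn_ge0 ?expR_ge0 ?fourier_weight_ge0.
under eq_bigr => J _.
  rewrite (ge0_integralZl H measurableT (mw J)); first last.
  - by rewrite lee_fin exprn_ge0 ?expR_ge0.
  - by move=> h _; rewrite lee_fin fourier_weight_ge0.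
  rewrite -(fineK (fin J)) -EFinM.
  over.
rewrite sumEFin/=; apply: eq_bigr => J _.
by rewrite mulrC -expRM_natl mulNr -mulrN.
Qed.

(** Convexity of [D] is what allows [f] to be replaced by [g] at the intermediate point as well. *)
Lemma eq_log_convex (R : realType) (D : set R) (f g : R -> R) :
  convex_set (D : set R^o) -> {in D, f =1 g} -> log_convex D g -> log_convex D f.
Proof.
move=> cD fg [g0 cg]; split=> [t Dt|l x y Dx Dy].
  by rewrite fg ?inE//; exact: g0.
by rewrite !fg//; [exact: cg|exact: cD].
Qed.

Theorem theorem3p5 (R : realType) (d : nat) (U : pointedType)
    (countU : countable [set: U]) (H : hash_family R d U) :
  log_convex `[0, +oo[ (collision H).
Proof.
apply: eq_log_convex => [x y l|t|].
- rewrite !inE/= !in_itv/= !andbT => x0 y0.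
  by rewrite addr_ge0 ?mulr_ge0// subr_ge0.
- by rewrite inE/= in_itv/= andbT; exact: collisionE.
apply: (log_convex_sum_expR _ (j := finset.set0)) => [J|].
  by apply: Rintegral_ge0 => h _; exact: fourier_weight_ge0.
(* Since [H] has total mass one, the constant lower bound on the weight at the empty set passes to
   its average. *)
apply: (@lt_le_trans _ _ (\int[H]_(h in [set: hash_fun d U]) 4^-1 ^+ d)%R).
  by rewrite Rintegral_cst// [X in fine X]probability_setT mulr1 exprn_gt0 ?invr_gt0.
apply: le_Rintegral => //; first last.
- by move=> h _; exact: fourier_weight0_ge.
- exact: integrable_fourier_weight.
- exact: finite_measure_integrable_cst.
Qed.
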